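(* Let $p$ be an odd prime and $i\in\{1,2\}$. Then $p$ is rogue of the $i^{\text{th}}$ kind if and only if $2$ is not a primitive root modulo $p$.
   Context: For an odd prime $p$ and $i\in\{1,2\}$, let $A_i^p=(\mathbb{Z}/p\mathbb{Z})^\times\setminus\{(-1)^i \bmod p\}$. For $g\in A_i^p$ define $u_1=g$ and $u_n=2u_{n-1}+(-1)^{i+1}$ in $\mathbb{Z}/p\mathbb{Z}$ for $n>1$; let $g_k^i=\min(\{n\in\mathbb{N}: u_n=0\}\cup\{\infty\})$, and call $\langle g\rangle_i^p=(u_n)_{1\le n<g_k^i}$ the rogue sequence of $g$. A rogue sequence which is periodic (equivalently, never reaches $0$, so $g_k^i=\infty$) is called a rogue loop. The prime $p$ is rogue of the $i^{\text{th}}$ kind if there exists $g\in A_i^p$ such that $\langle g\rangle_i^p$ is a rogue loop. *)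

(* Defs.v *)
From HB Require Import structures.
From mathcomp Require Import all_boot all_order all_algebra.
From mathcomp Require Import boolp.

Set Implicit Arguments.
Unset Strict Implicit.
Unset Printing Implicit Defensive.

Import GRing.Theory.
Local Open Scope ring_scope.

(* 'F_p is Z/pZ only when p is prime. *)
Definition A (i p : nat) : {set 'F_p} :=
  [set g : 'F_p | (g \is a GRing.unit) && (g != (-1) ^+ i)].

(* Indices start at 1: u i g 1 = g. The value at index 0 is junk and is never
   used. *)
Definition u (p i : nat) (g : 'F_p) (n : nat) : 'F_p :=
  iter n.-1 (fun x : 'F_p => 2 * x + (-1) ^+ i.+1) g.

Definition hits0 (p i : nat) (g : 'F_p) : pred nat :=
  fun n => (0 < n)%N && (u i g n == 0).

(* g_k^i, as an element of the positive integers extended by None = infinity. *)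
Definition rogue_index (p i : nat) (g : 'F_p) : option nat :=
  if pselect (exists n, hits0 i g n) is left ex then Some (ex_minn ex)
  else None.

Definition lt_ext (n : nat) (b : option nat) : bool :=
  if b is Some m then (n < m)%N else true.

(* A finite or infinite sequence (s_n)_{1 <= n < b} is represented by a function
   that is None exactly at the indices outside its domain. *)
Definition rogue_seq (p i : nat) (g : 'F_p) (n : nat) : option 'F_p :=
  if (0 < n)%N && lt_ext n (rogue_index i g) then Some (u i g n) else None.

(* A periodic sequence is in particular infinite. *)
Definition periodic (T : Type) (s : nat -> option T) : Prop :=
  (forall n, (0 < n)%N -> s n <> None) /\
  (exists2 t, (0 < t)%N & forall n, (0 < n)%N -> s (n + t)%N = s n).

Definition rogue_loop (p i : nat) (g : 'F_p) : Prop := periodic (rogue_seq i g).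

Definition rogue (i p : nat) : Prop := exists2 g, g \in A i p & rogue_loop i g.

(* For a prime p: the class of a has multiplicative order totient p modulo p. *)
Definition primitive_root_mod (a p : nat) : Prop :=
  (totient p).-primitive_root (a%:R : 'F_p).

(* Main.v *)
(** The affine map [x |-> 2 x - c], with [c = (-1)^i], fixes [c], so that
    [u_n - c = 2^(n-1) (g - c)].  Since [c^2 = 1], the sequence vanishes at [n]
    exactly when [2^(n-1) (1 - c g) = 1].  Hence [g] yields a loop if and only
    if [1 - c g] lies outside the subgroup generated by [2], and such a [g]
    exists in [A_i] if and only if that subgroup is proper. *)
Require Import Defs.
From HB Require Import structures.
From mathcomp Require Import all_boot all_order all_algebra.
From mathcomp Require Import finfield boolp.

Set Implicit Arguments.
Unset Strict Implicit.
Unset Printing Implicit Defensive.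

Import GRing.Theory.

Section PrimeField.
Local Open Scope ring_scope.
Variable p : nat.
Hypothesis p_prime : prime p.

Lemma Fp_expf_totient (x : 'F_p) : x != 0 -> x ^+ totient p = 1.
Proof.
move=> x0; apply: (mulfI x0); rewrite mulr1 -exprS totient_prime //.
by rewrite prednK ?prime_gt0 // -[X in _ ^+ X](card_Fp p_prime) expf_card.
Qed.

Lemma Fp_two_neq0 : odd p -> (2 : 'F_p) != 0.
Proof.
move=> p_odd; rewrite -(dvdn_pcharf (pchar_Fp p_prime)).
by rewrite dvdn_prime2 //; apply: contraL p_odd => /eqP ->.
Qed.

(** A counting argument: if [z] has order [d], its at most [d] powers cannot cover the [p - 1]
    nonzero residues unless [d = totient p]. *)
Lemma nonprimitive_missing_power (z : 'F_p) : z != 0 ->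
  ~ (totient p).-primitive_root z ->
  exists2 h : 'F_p, h != 0 & forall k, h != z ^+ k.
Proof.
move=> z0 nprim.
have [] := prim_order_exists _ (Fp_expf_totient z0).
  by rewrite totient_gt0 prime_gt0.
move=> d dprim d_dvd; pose powers := [set z ^+ (val k) | k : 'I_d].
have /subsetPn [h] : ~~ ([set~ (0 : 'F_p)] \subset powers).
  apply/negP => /subset_leq_card; rewrite cardsC1 card_Fp // => le_p.
  have le_d : (totient p <= d)%N.
    rewrite totient_prime //; apply: leq_trans le_p _.
    by rewrite -[X in (_ <= X)%N](card_ord d) leq_imset_card.
  apply: nprim; suff -> : totient p = d by [].
  apply/eqP; rewrite eqn_leq le_d dvdn_leq // totient_gt0; exact: prime_gt0.
rewrite !inE => h0 hpow; exists h => // k; apply: contra hpow => /eqP hk.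
have zd : (k %% d < d)%N by rewrite ltn_mod (prim_order_gt0 dprim).
by apply/imsetP; exists (Ordinal zd) => //=; rewrite prim_expr_mod.
Qed.

Variable i : nat.
Let c : 'F_p := (-1) ^+ i.

Lemma u_closed_form (g : 'F_p) n :
  u i g n.+1 = 2 ^+ n * (g - c) + c.
Proof.
rewrite /u /=; elim: n => [|n IHn]; first by rewrite expr0 mul1r subrK.
rewrite iterS IHn mulrDr mulrA -exprS -addrA; congr (_ + _).
by rewrite exprS mulN1r -/c mulr_natl mulr2n addrK.
Qed.

Lemma hits0S (g : 'F_p) n : hits0 i g n.+1 = (2 ^+ n * (1 - c * g) == 1).
Proof.
have cc : c * c = 1 by rewrite -expr2 sqrr_sign.
have c0 : - c != 0 by rewrite oppr_eq0 signr_eq0.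
(* Multiplying by [- c] turns [g - c] into [1 - c * g] and the trailing [c] into [-1]. *)
rewrite /hits0 /= u_closed_form -(inj_eq (mulfI c0)) mulr0 mulrDr.
by rewrite mulrCA mulrBr !mulNr cc opprK [- _ + 1]addrC subr_eq0.
Qed.

Lemma rogue_index_None (g : 'F_p) :
  (forall n, ~~ hits0 i g n) -> rogue_index i g = None.
Proof.
move=> nohit; rewrite /rogue_index; case: pselect => // -[n hn].
by have := nohit n; rewrite hn.
Qed.

Lemma rogue_loopP (g : 'F_p) : odd p ->
  rogue_loop i g <-> forall n, ~~ hits0 i g n.
Proof.
move=> p_odd; split.
  case=> infinite _ n; apply/negP => hn; case ri: (rogue_index i g) => [m|].
    (* A finite index [m] would leave the sequence undefined at [m] itself. *)
    have m_gt0 : (0 < m)%N.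
      move: ri; rewrite /rogue_index; case: pselect => // ex [<-].
      by case: ex_minnP => k /andP[].
    by apply: (infinite m m_gt0); rewrite /rogue_seq ri /= ltnn andbF.
  move: ri; rewrite /rogue_index; case: pselect => // nex _.
  by apply: nex; exists n.
move=> /rogue_index_None ri; split=> [n n0|].
  by rewrite /rogue_seq ri n0.
(* By Fermat, [2 ^+ totient p = 1], so the closed form has this period. *)
exists (totient p) => [|[//|n] _]; first by rewrite totient_gt0 prime_gt0.
rewrite /rogue_seq ri addSn /= !u_closed_form exprD.
by rewrite Fp_expf_totient ?mulr1 // Fp_two_neq0.
Qed.

End PrimeField.

Theorem mainTheorem2 (p i : nat) (p_prime : prime p) (p_odd : odd p)
  (hi : i = 1 \/ i = 2) :
  rogue i p <-> ~ primitive_root_mod 2 p.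
Proof.
have two0 := Fp_two_neq0 p_prime p_odd.
have cc : ((-1) ^+ i * (-1) ^+ i = 1 :> 'F_p)%R by rewrite -expr2 sqrr_sign.
split.
  case=> g; rewrite inE => /andP[_ gc] /(rogue_loopP p_prime _ _ p_odd) nohit prim.
  have h0 : (1 - (-1) ^+ i * g != 0 :> 'F_p)%R.
    rewrite subr_eq0; apply: contra gc => /eqP cg.
    by apply/eqP; rewrite -[LHS]mul1r -[X in (X * _)%R]cc -mulrA -cg mulr1.
  have [k hk] := prim_rootP prim (Fp_expf_totient p_prime h0).
  (* Here [1 - c g = 2 ^+ k] with [k < totient p]; the complementary power of 2 brings the product
     to 1. *)
  have /negP[] := nohit (totient p - k).+1.
  by rewrite hits0S // hk -exprD subnK ?Fp_expf_totient // ltnW.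
move=> /(nonprimitive_missing_power p_prime two0) [h h0 hpow].
(* The witness solves [1 - c g = h] for [g]. It is a unit because [h] differs from [2 ^+ 0], and it
   is not [c] because [h] is nonzero. *)
have gE : (1 - (-1) ^+ i * ((-1) ^+ i * (1 - h)) = h :> 'F_p)%R.
  by rewrite mulrA cc mul1r opprB addrC subrK.
exists ((-1) ^+ i * (1 - h))%R.
  rewrite inE unitfE mulf_neq0 ?signr_eq0 //=; last first.
    by rewrite subr_eq0 eq_sym; apply: hpow 0.
  apply: contra h0 => /eqP gc; rewrite -gE gc cc subrr; exact: eqxx.
apply/(rogue_loopP p_prime _ _ p_odd) => -[//|n]; rewrite hits0S // gE.
(* A zero would make [h] the inverse of [2 ^+ n], which is itself this power of 2. *)
apply/negP => /eqP hn; have /negP[] := hpow (n * (totient p).-1).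
apply/eqP/(mulfI (expf_neq0 n two0)); rewrite hn -exprD -mulnS.
by rewrite prednK ?totient_gt0 ?prime_gt0 // mulnC exprM Fp_expf_totient // expr1n.
Qed.
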